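(* Let $p$ be a prime and let $\mathbb{F}$ be an algebraic closure of $\mathbb{F}_p$. For $k\ge 0$ let $Pol_k$ be the $(k+1)$-dimensional $\mathbb{F}$-vector space of homogeneous polynomials of degree $k$ in two variables $x,y$ over $\mathbb{F}$, viewed as a representation of $SL_2(\mathbb{F}_p)$ via $$\rho_{Pol_k}(g)\cdot P(x,y)=P(ax+cy,\,bx+dy),\qquad g=\begin{pmatrix} a&b\\ c&d\end{pmatrix}\in SL_2(\mathbb{F}_p),\ P\in Pol_k.$$ Then for every $0\le k\le p-1$ the representation $Pol_k$ of $SL_2(\mathbb{F}_p)$ is irreducible. *)

(* Defs.v *)
From HB Require Import structures.
From mathcomp Require Import all_boot all_order all_algebra all_fingroup.
From mathcomp Require Import mxrepresentation.
From mathcomp Require Import mpoly.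

Set Implicit Arguments.
Unset Strict Implicit.
Unset Printing Implicit Defensive.

Import GRing.Theory.
Local Open Scope ring_scope.

Section LeftRepresentations.

Variables (F : fieldType) (gT : finGroupType) (G : {group gT}) (V : vectType F).

(* Left actions, as opposed to the row-vector (right) convention of
   mxrepresentation; only the values on G are meaningful. *)
Record linrep := LinRep {
  linrep_fun :> gT -> 'End(V);
  linrep1 : linrep_fun 1%g = \1%VF;
  linrepM : {in G &, forall g h,
    linrep_fun (g * h)%g = (linrep_fun g \o linrep_fun h)%VF}
}.

Definition subrep (rho : linrep) (U : {vspace V}) : Prop :=
  forall g, g \in G -> (rho g @: U <= U)%VS.

Definition irreducible (rho : linrep) : Prop :=
  (0 < \dim {:V})%N /\
  forall U : {vspace V}, subrep rho U -> U = 0%VS \/ U = fullv.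

Import VectorInternalTheory.

(* g acts by g^-1 in order to turn the left action into a right one. *)
Definition linrep_mx (rho : linrep) (g : gT) : 'M[F]_(dim V) :=
  f2mx (rho g^-1%g).

Lemma linrep_mx_repr (rho : linrep) : mx_repr G (linrep_mx rho).
Proof.
split=> [|g h Gg Gh]; rewrite /linrep_mx.
  rewrite invg1 linrep1; apply/row_matrixP=> i; rewrite rowE [RHS]rowE.
  have := id_lfunE (r2v (delta_mx 0 i) : V); rewrite unlock /= r2vK.
  by move/(congr1 v2r); rewrite !r2vK mulmx1.
rewrite invMg linrepM ?groupV //.
apply/row_matrixP=> i; rewrite rowE [RHS]rowE.
have := comp_lfunE (rho h^-1%g) (rho g^-1%g) (r2v (delta_mx 0 i)).
by rewrite !unlock /= !r2vK => /(congr1 v2r); rewrite !r2vK mulmxA.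
Qed.

Canonical linrep_mx_representation (rho : linrep) :=
  MxRepresentation (linrep_mx_repr rho).

Lemma irreducible_mxP (rho : linrep) :
  irreducible rho <-> mx_irreducible (linrep_mx_representation rho).
Proof.
have modP (U : {vspace V}) :
    subrep rho U <-> mxmodule (linrep_mx_representation rho) (vs2mx U).
  have stabE (f : 'End(V)) :
      (f @: U <= U)%VS = (vs2mx U *m f2mx f <= vs2mx U)%MS.
    by rewrite /lfun_img (locked_withE lfun_img_key) /lfun_img_def /subsetv mx2vsK.
  split=> [sU | /mxmoduleP mU g Gg].
    by apply/mxmoduleP=> g Gg; rewrite -stabE; apply/sU/groupVr.
  by have := mU _ (groupVr Gg); rewrite /= /linrep_mx invgK stabE.
rewrite mx_irrP /irreducible dimvf; split=> -[dV irr]; split=> // U.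
  move=> mU nzU; have := irr (mx2vs U); case.
  - by apply/modP; rewrite (eqmx_module _ (mx2vsK U)).
  - move/(congr1 (@dimv _ _)); rewrite dimv0 /dimv (mx2vsK U) => /eqP.
    by rewrite mxrank_eq0 (negPf nzU).
  - move/(congr1 (@dimv _ _)); rewrite dimvf /dimv (mx2vsK U) => rU.
    by rewrite /row_full rU.
move/modP=> mU; have [->|nzU] := eqVneq U 0%VS; [by left | right].
have rU: \rank (vs2mx U) = dim V.
  apply/eqP/irr => //; apply: contraNneq nzU => U0.
  by rewrite -dimv_eq0 /dimv U0 mxrank0.
by apply/eqP; rewrite eqEdim subvf dimvf /dimv rU /=.
Qed.

End LeftRepresentations.

Section SpecialLinearGroup.

Variables (n : nat) (R : finComUnitRingType).

Definition SLset : {set {'GL_n[R]}} := [set g | \det (GLval g) == 1].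

Lemma SLset_group_set : group_set SLset.
Proof.
apply/group_setP; split=> [|g h]; rewrite !inE; first by rewrite GL_1E det1.
by move=> /eqP dg /eqP dh; rewrite GL_ME det_mulmx dg dh mulr1.
Qed.

Canonical SLgroup : {group {'GL_n[R]}} := Group SLset_group_set.

End SpecialLinearGroup.

Arguments SLset n%_N R%_type.
Arguments SLgroup n%_N R%_type.

Definition SL2 (p : nat) : {group {'GL_2(p)}} := SLgroup 2 'F_p.

Section PolRepresentation.

Variables (p : nat) (F : fieldType) (iota : {rmorphism 'F_p -> F}) (k : nat).

Definition Pol : vectType F := dhomog 2 F k.

Lemma dim_Pol : \dim {:Pol} = k.+1.
Proof. by rewrite dimvf /dim /= addn1 binSn. Qed.

Local Notation x := ('X_ord0 : {mpoly F[2]}).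
Local Notation y := ('X_ord_max : {mpoly F[2]}).

(* The pair (a x + c y, b x + d y) for g = (a b; c d). *)
Definition lin_subst (g : {'GL_2(p)}) : 2.-tuple {mpoly F[2]} :=
  let a := iota (GLval g ord0 ord0) in let b := iota (GLval g ord0 ord_max) in
  let c := iota (GLval g ord_max ord0) in
  let d := iota (GLval g ord_max ord_max) in
  [tuple a *: x + c *: y; b *: x + d *: y].

Lemma lin_subst_homog (g : {'GL_2(p)}) (P : {mpoly F[2]}) :
  P \is k.-homog -> P \mPo lin_subst g \is k.-homog.
Proof.
have homX (i : 'I_2) : ('X_i : {mpoly F[2]}) \is 1.-homog.
  by rewrite dhomogX /= mdeg1.
move=> /dhomogP homP; rewrite comp_mpolyEX big_seq rpred_sum // => m /homP mk.
rewrite rpredZ // comp_mpolyX -mk /= mdegE big_ord_recl big_ord1.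
rewrite big_ord_recl big_ord1.
apply: dhomogM; rewrite -[X in X.-homog]mul1n; apply: dhomogMn.
  by rewrite (tnth_nth 0) /= rpredD // rpredZ.
by rewrite (tnth_nth 0) /= rpredD // rpredZ.
Qed.

Definition pol_act (g : {'GL_2(p)}) (P : Pol) : Pol :=
  DHomog (lin_subst_homog g (dhomog_is_dhomog P)).

Lemma pol_act_is_linear g : linear (pol_act g).
Proof. by move=> a P Q; apply: val_inj; rewrite /= linearP. Qed.

HB.instance Definition _ g :=
  GRing.isLinear.Build F Pol Pol _ (pol_act g) (pol_act_is_linear g).

Definition pol_fun (g : {'GL_2(p)}) : 'End(Pol) := linfun (pol_act g).

Lemma pol_fun1 : pol_fun 1%g = \1%VF.
Proof.
apply/lfunP=> P; rewrite lfunE id_lfunE; apply: val_inj => /=.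
rewrite -[RHS]comp_mpoly_id; congr (_ \mPo _); apply: eq_from_tnth => i.
rewrite tnth_mktuple (tnth_nth 0) /lin_subst /= !mxE /=.
rewrite !rmorph1 !rmorph0 !scale1r !scale0r addr0 add0r.
by case: i => [[|[|//]] ?] /=; congr 'X_ _; apply: val_inj.
Qed.

Lemma pol_funM : {in SL2 p &, forall g h,
  pol_fun (g * h)%g = (pol_fun g \o pol_fun h)%VF}.
Proof.
move=> g h _ _; apply/lfunP=> P; rewrite comp_lfunE !lfunE.
apply: val_inj => /=.
rewrite comp_mpolyEX [in RHS](comp_mpolyEX (P : {mpoly F[2]})) linear_sum /=.
apply: eq_bigr => m _; rewrite linearZ /=; congr (_ *: _).
rewrite !comp_mpolyX rmorph_prod /=; apply: eq_bigr => i _.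
rewrite rmorphXn /=; congr (_ ^+ _); rewrite !(tnth_nth 0).
have entry j l : GLval (g * h)%g j l
    = GLval g j ord0 * GLval h ord0 l + GLval g j ord_max * GLval h ord_max l.
  by rewrite GL_MxE mxE big_ord_recl big_ord1; congr (_ + _ * _);
    congr (GLval _ _ _); apply: val_inj.
case: i => [[|[|//]] ?] /=; rewrite !entry !rmorphD !rmorphM /=;
  rewrite !linearZ /= !comp_mpolyXU /= !scalerDr !scalerDl !scalerA;
  by rewrite addrACA ![iota (GLval h _ _) * _]mulrC.
Qed.

Definition pol_rep : linrep (SL2 p) Pol := LinRep pol_fun1 pol_funM.

End PolRepresentation.

(* Main.v *)
(** Let [U] be a nonzero subrepresentation containing [P], and let [t] range over
    [F_p].  The polynomials [P(x, t x + y)] lie in [U] and depend polynomially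
    on [t] with degree at most [k < p], so a Vandermonde argument puts each of
    their coefficients in [t] in [U].  If [m] is the degree of [P] in [y], the
    coefficient of [t^m] is a nonzero multiple of [x^k].  Applying the same
    argument to [(x + t y)^k] yields all the [C(k, j) x^(k-j) y^j], and
    [C(k, j)] is nonzero in [F] as [k < p]. *)

Require Import Defs.
From mathcomp Require Import all_boot all_algebra.
From mathcomp Require Import fingroup mpoly.
Local Open Scope ring_scope.

Set Implicit Arguments.
Unset Strict Implicit.
Unset Printing Implicit Defensive.

Import GRing.Theory.

(** The weights form column [j] of the inverse of the Vandermonde matrix at the nodes [e t]. Applied
    to the values at the nodes of a polynomial of degree below [n], they extract its coefficient of
    index [j]. *)
Lemma interpolation_weights (F : fieldType) (n : nat) (e : 'I_n -> F) :
  injective e -> forall j : 'I_n, exists w : 'I_n -> F,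
  forall i : 'I_n, \sum_t w t * e t ^+ i = (i == j)%:R.
Proof.
move=> inj_e j; pose V := Vandermonde n (\row_t e t).
have unitV : V \in unitmx.
  rewrite unitmxE unitfE det_Vandermonde prodf_seq_neq0.
  apply/allP=> i _ /=; rewrite prodf_seq_neq0; apply/allP=> l _ /=.
  apply/implyP=> lt_il; rewrite !mxE subr_eq0 (inj_eq inj_e).
  by rewrite -val_eqE /= gtn_eqF.
exists (fun t => (invmx V *m delta_mx j (0 : 'I_1)) t 0) => i.
have := mulKVmx unitV (delta_mx j (0 : 'I_1)) => /matrixP/(_ i 0).
by rewrite !mxE eqxx andbT => <-; apply: eq_bigr => t _; rewrite !mxE mulrC.
Qed.

Lemma Fp_nat_inj_lt (p : nat) : prime p ->
  {in gtn p &, injective (fun n => n%:R : 'F_p)}.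
Proof.
move=> p_pr m n lt_m lt_n /(congr1 (@nat_of_ord _)).
by rewrite !val_Fp_nat // !modn_small.
Qed.

(** All factors of [k!] are below [p], so [p] does not divide [k!], nor its divisor ['C(k, j)]; the
    injectivity of [iota] carries this to [F]. *)
Lemma bin_lt_prime_neq0 (p : nat) (F : fieldType) (iota : {rmorphism 'F_p -> F})
    (k j : nat) :
  prime p -> (j <= k)%N -> (k < p)%N -> 'C(k, j)%:R != 0 :> F.
Proof.
move=> p_pr le_jk lt_kp; rewrite -(rmorph_nat iota) fmorph_eq0.
have coprime_fact : coprime p k`!.
  rewrite prime_coprime //; elim: k lt_kp {le_jk} => [|k IHk] lt_kp.
    by rewrite dvdn1; case: p p_pr {iota lt_kp} => [|[|]].
  rewrite factS Euclid_dvdM // negb_or IHk ?(ltnW lt_kp) // andbT.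
  by apply/negP=> /(dvdn_leq (ltn0Sn _)); rewrite leqNgt lt_kp.
apply/negP=> /eqP/(congr1 (@nat_of_ord _)); rewrite val_Fp_nat //= => /eqP p_bin.
move: coprime_fact; rewrite prime_coprime // -(bin_fact le_jk) => /negP[].
exact: dvdn_mulr.
Qed.

(** The sum runs up to [n] rather than [i] so that expansions of different powers share one index
    set; the added terms vanish because ['C(i, j)] is 0 for [j > i]. *)
Lemma exprDnZ_widen (F : fieldType) (A : comAlgType F) (a b : A) (t : F)
    (i n : nat) : (i <= n)%N ->
  (a + t *: b) ^+ i =
    \sum_(j < n.+1) t ^+ j *: ('C(i, j)%:R *: (a ^+ (i - j) * b ^+ j)).
Proof.
move=> le_in; pose G j := (a ^+ (i - j) * (t *: b) ^+ j) *+ 'C(i, j).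
rewrite exprDn (big_ord_widen n.+1 G) //.
rewrite big_mkcond /G; apply: eq_bigr => j _; case: ltnP => [_|lt_ij].
  by rewrite exprZn -scalerAr -scaler_nat !scalerA mulrC.
by rewrite bin_small // scale0r scaler0.
Qed.

Section PolSubrep.

Variables (p : nat) (F : fieldType) (iota : {rmorphism 'F_p -> F}) (k : nat).

Local Notation x := ('X_ord0 : {mpoly F[2]}).
Local Notation y := ('X_ord_max : {mpoly F[2]}).

Lemma homog2_sum (P : {mpoly F[2]}) : P \is k.-homog ->
  exists c : 'I_k.+1 -> F, P = \sum_i c i *: (x ^+ (k - i) * y ^+ i).
Proof.
move=> /dhomogP homP; rewrite [P]mpolyE big_seq.
elim/big_ind: _ => [|_ _ [c ->] [d ->]|m /homP deg_m].
- by exists (fun=> 0); rewrite big1 // => i _; rewrite scale0r.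
- exists (fun i => c i + d i); rewrite -big_split; apply: eq_bigr => i _.
  by rewrite scalerDl.
have degE : (m ord0 + m ord_max)%N = k.
  rewrite -deg_m /= mdegE big_ord_recl big_ord1; congr (_ + m _)%N.
  exact: val_inj.
have le_mk : (m ord_max < k.+1)%N by rewrite ltnS -degE leq_addl.
exists (fun i => if i == Ordinal le_mk then P@_m else 0).
rewrite (bigD1 (Ordinal le_mk)) //= eqxx big1 ?addr0; last first.
  by move=> i /negPf ->; rewrite scale0r.
rewrite -degE addnK mpolyXE_id big_ord_recl big_ord1.
have -> : lift ord0 ord0 = ord_max :> 'I_2 by apply: val_inj.
by [].
Qed.

Variable U : {vspace Pol F k}.

Lemma coef_subrep (f : 'I_k.+1 -> {mpoly F[2]}) : prime p -> (k < p)%N ->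
    (forall t : 'F_p, exists2 u : Pol F k, u \in U &
       val u = \sum_(i < k.+1) iota t ^+ i *: f i) ->
  forall j, exists2 u : Pol F k, u \in U & val u = f j.
Proof.
move=> p_pr lt_kp /fin_all_exists2[u Uu uE] j.
(* The nodes are the images of 0, ..., [k], which are distinct modulo [p] because [k < p]. *)
have inj_e : injective (fun i : 'I_k.+1 => iota i%:R).
  move=> i l /fmorph_inj /(Fp_nat_inj_lt p_pr) eq_il; apply/val_inj/eq_il.
    exact: leq_trans (ltn_ord i) lt_kp.
  exact: leq_trans (ltn_ord l) lt_kp.
have [w wE] := interpolation_weights inj_e j.
exists (\sum_(t < k.+1) w t *: u t%:R).
  by rewrite rpred_sum // => t _; rewrite rpredZ.
rewrite (raddf_sum (@mpoly_of_dhomog 2 F k)).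
transitivity (\sum_(t < k.+1) \sum_(i < k.+1) (w t * iota t%:R ^+ i) *: f i).
  apply: eq_bigr => t _; transitivity (w t *: val (u t%:R)); first by [].
  by rewrite uE scaler_sumr; apply: eq_bigr => i _; rewrite scalerA.
rewrite exchange_big /= (bigD1 j) //= -scaler_suml wE eqxx scale1r.
by rewrite big1 ?addr0 // => i /negPf ne_ij; rewrite -scaler_suml wE ne_ij scale0r.
Qed.

Hypothesis subU : subrep (pol_rep iota k) U.

(** Lets a substitution be given by four entries: determinant 1 makes their matrix an element of
    [SL2 p], whose action preserves [U]. *)
Lemma subst_subrep (a b c d : 'F_p) (P : Pol F k) :
    a * d - b * c = 1 -> P \in U ->
  exists2 u : Pol F k, u \in U &
    val u = val P \mPo [tuple iota a *: x + iota c *: y; iota b *: x + iota d *: y].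
Proof.
move=> detA UP; pose A : 'M['F_p]_2 :=
  \matrix_(i, j) if i == 0 then if j == 0 then a else b
                 else if j == 0 then c else d.
have dA : \det A = 1.
  rewrite (expand_det_row _ 0) big_ord_recl big_ord1 /cofactor !det_mx11 !mxE /=.
  by rewrite expr0 mul1r expr1 mulN1r mulrN.
have uA : A \is a GRing.unit.
  by have := unitmxE A; rewrite dA unitr1.
exists (pol_rep iota k (FinRing.unit _ uA) P).
  have Gg : FinRing.unit _ uA \in SL2 p by rewrite inE /= dA.
  by have /subvP/(_ _ (memv_img _ UP)) := subU Gg.
by rewrite lfunE /= /lin_subst /= !mxE.
Qed.

Hypotheses (p_pr : prime p) (lt_kp : (k < p)%N).

Lemma Xk_subrep : U != 0%VS -> exists2 u : Pol F k, u \in U & val u = x ^+ k.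
Proof.
move=> nzU; have UP := memv_pick U.
have nzP : vpick U != 0 by rewrite vpick0.
move: (vpick U) => P in UP nzP *.
have [c PE] := homog2_sum (dhomog_is_dhomog P).
have /existsP[i0 nz_i0] : [exists i, c i != 0].
  apply: contraR nzP => /existsPn c0; apply/eqP/val_inj; rewrite /= PE.
  by rewrite big1 // => i _; move: (c0 i); rewrite negbK => /eqP ->; rewrite scale0r.
(* [m] is the degree of [P] in [y], and [f j] below is the coefficient of [t ^+ j] in
   [P(x, t x + y)]. *)
case: (@arg_maxnP _ i0 (fun i => c i != 0) (@nat_of_ord k.+1) nz_i0) => m nz_m max_m.
pose f (j : 'I_k.+1) : {mpoly F[2]} :=
  \sum_(i < k.+1) c i *: (x ^+ (k - i) * ('C(i, j)%:R *: (y ^+ (i - j) * x ^+ j))).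
have [t|u Uu uE] := @coef_subrep f p_pr lt_kp _ m.
  have [|u Uu uE] := @subst_subrep 1 t 0 1 P _ UP.
    by rewrite mulr1 mulr0 subr0.
  exists u => //; rewrite uE /= PE raddf_sum /=.
  under [RHS]eq_bigr do rewrite scaler_sumr.
  rewrite exchange_big; apply: eq_bigr => i _.
  rewrite linearZ rmorphM !rmorphXn /= !comp_mpolyXU /= rmorph1 rmorph0.
  rewrite !scale1r scale0r addr0 [_ + y]addrC.
  rewrite (@exprDnZ_widen _ _ y x _ i k) -1?ltnS //.
  rewrite mulr_sumr scaler_sumr; apply: eq_bigr => j _.
  by rewrite -scalerAr !scalerA mulrC.
exists ((c m)^-1 *: u); first by rewrite rpredZ.
transitivity ((c m)^-1 *: val u); first by [].
(* In [f m] only [i = m] survives, giving [c m *: x ^+ k]: for [i > m] the coefficient [c i] is 0 by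
   maximality, and for [i < m] the binomial ['C(i, m)] is 0. *)
rewrite uE /f (bigD1 m) //= big1 => [|i ne_im].
  rewrite addr0 binn subnn expr0 mul1r scale1r -exprD.
  rewrite subnK ?scalerA ?mulVf ?scale1r //.
  by rewrite -ltnS.
have [-> | nz_i] := eqVneq (c i) 0; first by rewrite scale0r.
have lt_im : (i < m)%N by rewrite ltn_neqAle val_eqE ne_im; apply: max_m.
by rewrite bin_small // scale0r mulr0 scaler0.
Qed.

Lemma monomial_subrep : U != 0%VS -> forall j : 'I_k.+1,
  exists2 u : Pol F k, u \in U & val u = x ^+ (k - j) * y ^+ j.
Proof.
move=> /Xk_subrep[P UP PE] j.
(* [f j] is the coefficient of [t ^+ j] in [(x + t y)^k], the image of [x ^+ k] under the lower
   unipotent matrix with entry [t]. *)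
pose f (j : 'I_k.+1) : {mpoly F[2]} := 'C(k, j)%:R *: (x ^+ (k - j) * y ^+ j).
have [t|u Uu uE] := @coef_subrep f p_pr lt_kp _ j.
  have [|u Uu uE] := @subst_subrep 1 0 t 1 P _ UP.
    by rewrite mulr1 mul0r subr0.
  exists u => //; rewrite uE PE rmorphXn /= comp_mpolyXU /= rmorph1 scale1r.
  exact: exprDnZ_widen.
have nzC : 'C(k, j)%:R != 0 :> F.
  by apply: (bin_lt_prime_neq0 iota) => //; rewrite -ltnS.
exists (('C(k, j)%:R)^-1 *: u); first by rewrite rpredZ.
transitivity (('C(k, j)%:R : F)^-1 *: val u); first by [].
by rewrite uE /f scalerA mulVf ?scale1r.
Qed.

Lemma subrep_fullv : U != 0%VS -> U = fullv.
Proof.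
move=> nzU; apply/vspaceP=> P; rewrite memvf.
have [c PE] := homog2_sum (dhomog_is_dhomog P).
have /fin_all_exists2[u Uu uE] := monomial_subrep nzU.
have -> : P = \sum_(i < k.+1) c i *: u i.
  apply: val_inj; rewrite /= PE (raddf_sum (@mpoly_of_dhomog 2 F k)).
  by apply: eq_bigr => i _; rewrite -uE.
by rewrite rpred_sum // => i _; rewrite rpredZ.
Qed.

End PolSubrep.

Theorem theorem2p2 (p : nat) (F : closedFieldType)
    (iota : {rmorphism 'F_p -> F}) (k : nat) :
  prime p -> (forall z : F, algebraicOver iota z) -> (k <= p.-1)%N ->
  irreducible (pol_rep iota k).
Proof.
move=> p_pr _ le_kp; split=> [|U subU]; first by rewrite dim_Pol.
have [->|nzU] := eqVneq U 0%VS; [by left | right].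
apply: (subrep_fullv subU p_pr) => //.
by rewrite -(prednK (prime_gt0 p_pr)) ltnS.
Qed.
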